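(* Let $\eta:[0,\infty]\to[0,\infty]$ be increasing with $\eta(0)=0$ and $\eta(\infty)=\infty$, and let $g_o:\mathbb{S}\to\mathbb{S}$ be an $\eta$-quasi-Möbius homeomorphism of the unit circle. Then $$\mathcal E(g_o)\ \leq\ \frac{1}{\pi}\int_0^{\pi/2}\log\big[\eta(\cot^2(t/2))\big]\,\cos(t)\,dt .$$ This estimate is sharp.
   Context: $\mathbb{S}$ is the unit circle in $\mathbb{C}$. For a homeomorphism $g_o:\mathbb{S}\to\mathbb{S}$, its conformal energy is $$\mathcal E(g_o)=-\frac{1}{2\pi^2}\iint_{\mathbb{S}\times\mathbb{S}}\log|g_o(\zeta)-g_o(\xi)|\,d\zeta\,d\bar\xi ,$$ that is, with $\zeta=e^{it}$, $\xi=e^{is}$, $$\mathcal E(g_o)=-\frac{1}{2\pi^2}\int_0^{2\pi}\int_0^{2\pi}\log|g_o(e^{it})-g_o(e^{is})|\cos(t-s)\,dt\,ds.$$ A homeomorphism $g_o$ of the circle is $\eta$-quasi-Möbius if for every quadruple of points $a,b,c,d\in\mathbb{S}$, $$\frac{|g_o(a)-g_o(b)||g_o(c)-g_o(d)|}{|g_o(a)-g_o(c)||g_o(b)-g_o(d)|}\leq\eta\left(\frac{|a-b||c-d|}{|a-c||b-d|}\right).$$ *)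

(* Defs.v *)
From mathcomp Require Export all_boot all_order all_algebra.
From mathcomp Require Export all_classical all_reals all_analysis.
From mathcomp Require Export complex.
Export Order.TTheory GRing.Theory Num.Theory numFieldNormedType.Exports.

Set Implicit Arguments.
Unset Strict Implicit.
Unset Printing Implicit Defensive.

Local Open Scope classical_set_scope.
Local Open Scope ring_scope.

(* The alias R[i]^o carries the topology of the complex plane. A map of the
   circle is a total map of the plane of which only the values on the circle
   are ever used. *)

(* The Euclidean distance, valued in R: the norm `|z| of z : R[i] is itself an
   element of R[i]. *)
Definition cdist (R : realType) (z w : R[i]^o) : R := Normc.normc (z - w).

Definition unit_circle (R : realType) : set R[i]^o := [set z | cdist z 0 = 1].
Arguments unit_circle R : clear implicits.

Definition expi (R : realType) (t : R) : R[i]^o := (cos t +i* sin t)%C.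

Definition circle_homeo (R : realType) (g : R[i]^o -> R[i]^o) : Prop :=
  exists h : R[i]^o -> R[i]^o,
    [/\ forall z, unit_circle R z -> unit_circle R (g z) /\ h (g z) = z,
        forall z, unit_circle R z -> unit_circle R (h z) /\ g (h z) = z,
        {within unit_circle R, continuous g} &
        {within unit_circle R, continuous h}].

(* The integrand is -oo on the diagonal. For a circle homeomorphism its
   positive part is bounded, so that the integral is defined in [-oo, +oo[ and
   the energy in ]-oo, +oo]. *)
Definition energy (R : realType) (g : R[i]^o -> R[i]^o) : \bar R :=
  ((- (2 * pi ^+ 2)^-1)%R%:E *
   \int[(lebesgue_measure \x lebesgue_measure)%E]_(p in
         `[0%R, (2 * pi : R)%R] `*` `[0%R, (2 * pi : R)%R])
     (lne (cdist (g (expi p.1)) (g (expi p.2)))%:E * (cos (p.1 - p.2)%R)%:E))%E.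

(* Division in \bar R: r / 0 = +oo for r > 0, and 0 / 0 = 0. *)
Definition cross_ratio (R : realType) (a b c d : R[i]^o) : \bar R :=
  ((cdist a b * cdist c d)%R%:E / (cdist a c * cdist b d)%R%:E)%E.

(* Only the restriction of eta to [0, +oo] matters. When eta 0 = 0,
   eta +oo = +oo and g is injective on the circle, the inequality holds
   automatically for the quadruples in which a quotient has a vanishing
   numerator or denominator. *)
Definition quasi_mobius (R : realType) (eta : \bar R -> \bar R)
    (g : R[i]^o -> R[i]^o) : Prop :=
  forall a b c d : R[i]^o,
    unit_circle R a -> unit_circle R b -> unit_circle R c -> unit_circle R d ->
    (cross_ratio (g a) (g b) (g c) (g d) <= eta (cross_ratio a b c d))%E.

(* "Increasing" is taken in the weak sense. *)
Definition control_function (R : realType) (eta : \bar R -> \bar R) : Prop :=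
  [/\ forall x, (0 <= x)%E -> (0 <= eta x)%E,
      forall x y, (0 <= x)%E -> (x <= y)%E -> (eta x <= eta y)%E,
      eta 0%E = 0%E & eta +oo%E = +oo%E].

Definition cot (R : realType) (t : R) : R := cos t / sin t.

(* The null set {0}, where cot (t / 2) is infinite, is left out. *)
Definition energy_bound (R : realType) (eta : \bar R -> \bar R) : \bar R :=
  ((pi^-1)%R%:E *
   \int[lebesgue_measure]_(t in `]0%R, (pi / 2 : R)%R])
     (lne (eta (cot (t / 2) ^+ 2)%R%:E) * (cos t)%:E))%E.

(* Main.v *)
Require Import Defs.
From mathcomp Require Import measurable_realfun ring lra.

(* With u = t - s, the weight cos u changes sign under u |-> u + pi, so the
   energy only depends on the averages over the rectangles with vertices
   e^{it}, e^{is}, -e^{it}, -e^{is} and cos u > 0 of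
     log |g(e^{it}) - g(-e^{is})| + log |g(-e^{it}) - g(e^{is})|
     - log |g(e^{it}) - g(e^{is})| - log |g(-e^{it}) - g(-e^{is})|.
   This is the logarithm of a cross-ratio of g, which is controlled by eta at
   the cross-ratio cot^2 (u / 2) of the rectangle. Every step but this last
   estimate is an equality, so the identity attains the bound for eta = id. *)

Set Implicit Arguments.
Unset Strict Implicit.
Unset Printing Implicit Defensive.
Local Open Scope classical_set_scope.
Local Open Scope ring_scope.
Local Arguments lne {R} x : simpl never.

(** Neither side of the inequality is known to be finite: the logarithm is -oo on the diagonal, and
    [eta] may take the value +oo. So the identity behind the estimate is never integrated as a
    difference. The integrand is split as [kerA g - kerB g] with nonnegative kernels, and the
    average over a rectangle becomes an equation between sums, [kerB_rectangle], so that Tonelli and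
    invariance under half-turns apply in [0, +oo]. Only [intA g] has to be cancelled; it is finite
    because [kerA g] sees the logarithm only where cos (t - s) < 0, away from the diagonal. The
    bound is nonnegative because a quadruple of cross-ratio 1 forces 1 <= [eta 1]. For sharpness the
    equality must not read +oo = +oo, so the integral for [eta = id] is shown to be finite through a
    primitive of its integrand. *)

(** * Translations, reflections and periodic integrands on the line *)

Section lebesgue_shift.
Variable R : realType.
Local Notation mu := (@lebesgue_measure R).
Implicit Types (a b c p : R) (f : R -> \bar R).

Lemma measurable_shift a : measurable_fun setT (+%R^~ a : R -> R).
Proof. by apply: measurable_funD => /=. Qed.

Lemma lebesgue_measure_shift a (A : set R) : measurable A ->
  pushforward mu (+%R^~ a : _ -> measurableTypeR R) A = mu A.
Proof.
move=> mA; apply/esym/lebesgue_measure_unique => //= [|? _ [[x y]] _ <-].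
  exact: measurable_shift.
rewrite /pushforward.
rewrite [X in _ = mu X](_ : _ = `]x - a, y - a]%classic); last first.
  by apply/seteqP; split => z /=; rewrite !in_itv/= ltrBlDr lerBrDr.
rewrite !lebesgue_measure_itv/= !lte_fin ltrD2r.
by case: ifP => // _; rewrite -!EFinD opprB addrA subrK.
Qed.

Lemma ge0_integral_shift a (D : set R) f : measurable D ->
  measurable_fun setT f -> (forall x, 0 <= f x)%E ->
  (\int[mu]_(x in +%R^~ a @^-1` D) f (x + a)%R = \int[mu]_(x in D) f x)%E.
Proof.
move=> mD mf f0.
transitivity (\int[mu]_(x in +%R^~ a @^-1` D) (f \o +%R^~ a) x)%E => //.
rewrite -(@ge0_integral_pushforward _ _ (measurableTypeR R)
  (measurableTypeR R) R _ (measurable_shift a) mu)//.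
- apply: eq_measure_integral => //= [|? A mA _]; first exact: measurable_shift.
  exact: lebesgue_measure_shift.
- exact: measurable_funTS.
Qed.

Lemma ge0_integral_reflect (D : set R) f : measurable D ->
  measurable_fun setT f -> (forall x, 0 <= f x)%E ->
  (\int[mu]_(x in -%R @^-1` D) f (- x)%R = \int[mu]_(x in D) f x)%E.
Proof.
move=> mD mf f0.
have mN : measurable_fun setT (-%R : R -> R) by exact: oppr_measurable.
transitivity (\int[mu]_(x in -%R @^-1` D) (f \o -%R) x)%E => //.
rewrite -(@ge0_integral_pushforward _ _ (measurableTypeR R)
  (measurableTypeR R) R _ mN mu)//.
- by apply: eq_measure_integral => //= A mA _; exact: lebesgue_measureN.
- exact: measurable_funTS.
Qed.

Lemma ge0_integral_itv_split a b c f : a <= b -> b <= c ->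
  measurable_fun setT f -> (forall x, 0 <= f x)%E ->
  (\int[mu]_(x in `]a, c]) f x =
   \int[mu]_(x in `]a, b]) f x + \int[mu]_(x in `]b, c]) f x)%E.
Proof.
move=> ab bc mf f0; rewrite (@itv_bndbnd_setU _ _ _ (BRight b))//.
rewrite ge0_integral_setU//; first exact: measurable_funTS.
rewrite disj_set2E; apply/eqP/seteqP; split => x //=.
by rewrite !in_itv/= => -[/andP[_ xb] /andP[]]; rewrite ltNge xb.
Qed.

(** The translated domain ]a, p + a] is cut at p, and the piece ]p, p + a] is moved back to ]0, a]
    by periodicity. Half-open intervals make the pieces tile exactly. *)
Lemma ge0_integral_periodic_shift p a f : 0 <= a <= p ->
  measurable_fun setT f -> (forall x, 0 <= f x)%E ->
  (forall x, f (x + p) = f x) ->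
  (\int[mu]_(x in `[0%R, p]) f (x + a)%R = \int[mu]_(x in `[0%R, p]) f x)%E.
Proof.
move=> /andP[a0 ap] mf f0 fp.
have mfa : measurable_fun setT (fun x : R => f (x + a)).
  by apply: measurableT_comp => //; exact: measurable_shift.
rewrite -!integral_itv_obnd_cbnd; try exact: measurable_funTS.
have shiftE (x y z : R) :
    `]x, y]%classic = +%R^~ z @^-1` `]x + z, y + z]%classic.
  by apply/seteqP; split => w /=; rewrite !in_itv/= ltrD2r lerD2r.
rewrite [in LHS](shiftE _ _ a) ge0_integral_shift// add0r.
rewrite (@ge0_integral_itv_split a p)//; last by rewrite lerDl.
rewrite (@ge0_integral_itv_split 0 a p)//.
rewrite addeC; congr (_ + _)%E.
rewrite [X in integral _ X _](_ : _ = `]0 + p, a + p]%classic); last first.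
  by rewrite add0r addrC.
rewrite -(@ge0_integral_shift p)// -shiftE.
by apply: eq_integral => x _; rewrite fp.
Qed.

Lemma ge0_integral_even_periodic p f :
  measurable_fun setT f -> (forall x, 0 <= f x)%E ->
  (forall x, f (x + p) = f x) -> (forall x, f (- x) = f x) ->
  forall q, p = q + q -> 0 <= q ->
  (\int[mu]_(x in `[0%R, p]) f x =
   \int[mu]_(x in `[0%R, q]) f x + \int[mu]_(x in `[0%R, q]) f x)%E.
Proof.
move=> mf f0 fp fN q pq q0.
rewrite -!integral_itv_obnd_cbnd; try exact: measurable_funTS.
rewrite (@ge0_integral_itv_split 0 q)// ?pq ?lerDl//; congr (_ + _)%E.
rewrite integral_itv_obnd_cbnd; last exact: measurable_funTS.
transitivity (\int[mu]_(x in `[0%R, q]) f x)%E; last first.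
  by rewrite integral_itv_obnd_cbnd//; exact: measurable_funTS.
(* The second half ]q, p] is brought to [0, q] by x |-> p - x, composed of a shift and a reflection,
   both of which preserve [f]. *)
rewrite -(@ge0_integral_shift p)//.
rewrite -ge0_integral_reflect//; last 2 first.
- by rewrite -[X in measurable X]setTI; exact: measurable_shift.
- by apply: measurableT_comp => //; exact: measurable_shift.
rewrite [X in integral _ X _](_ : _ = `[0%R, q]%classic).
  by apply: eq_integral => x _; rewrite fp fN.
apply/seteqP; split => x /=; rewrite !in_itv/= pq => /andP[? ?].
  by apply/andP; lra.
by apply/andP; lra.
Qed.

End lebesgue_shift.

(** * Measurability of monotone functions, and differences with an infinite subtrahend *)

Lemma nondecreasing_emeasurable (R : realType) (f : R -> \bar R) :
  {homo f : x y / x <= y >-> (x <= y)%E} -> measurable_fun setT f.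
Proof.
move=> f_nd.
apply: (measurability (@ErealGenCInfty.G R)) => [|/= _ [_] [r] -> <-].
  exact: ErealGenCInfty.measurableE.
apply: measurableI => //; apply: is_interval_measurable => s t /=.
rewrite !in_itv/= !andbT => fs ft u /andP[su ut].
by rewrite in_itv/= andbT (le_trans fs)// f_nd.
Qed.

(** The integral of [f2] may be +oo, so linearity for integrable functions does not apply. Instead
    f^+ + f2 = f^- + f1 is integrated as an equation between nonnegative functions; f^+ <= f1 keeps
    the integral of f^+ finite, which allows solving for the difference. *)
Lemma ge0_integral_difference d (T : measurableType d) (R : realType)
    (mu : {measure set T -> \bar R}) (D : set T) (f f1 f2 : T -> \bar R) :
  measurable D -> measurable_fun D f1 -> measurable_fun D f2 ->
  (forall x, D x -> 0 <= f1 x < +oo)%E -> (forall x, D x -> 0 <= f2 x)%E ->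
  (forall x, D x -> f x = f1 x - f2 x)%E ->
  (\int[mu]_(x in D) f1 x < +oo)%E ->
  (\int[mu]_(x in D) f x = \int[mu]_(x in D) f1 x - \int[mu]_(x in D) f2 x)%E.
Proof.
move=> mD mf1 mf2 f1fin f2ge fE If1.
have f1ge x : D x -> (0 <= f1 x)%E by move=> /f1fin/andP[].
have mf : measurable_fun D f.
  apply: (eq_measurable_fun (fun x => f1 x - f2 x)%E).
    by move=> x /set_mem/fE ->.
  exact: emeasurable_funB.
have mp : measurable_fun D (f^\+)%E by exact: measurable_funepos.
have mn : measurable_fun D (f^\-)%E by exact: measurable_funeneg.
have ppos x : D x -> (0 <= f^\+ x)%E by [].
have npos x : D x -> (0 <= f^\- x)%E by [].
have ple : (\int[mu]_(x in D) f^\+ x <= \int[mu]_(x in D) f1 x)%E.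
  apply: ge0_le_integral => // x Dx.
  rewrite funeposE fE// ge_max f1ge// andbT.
  by apply: geeDl; rewrite oppe_le0 f2ge.
have key : (\int[mu]_(x in D) f^\+ x + \int[mu]_(x in D) f2 x =
            \int[mu]_(x in D) f^\- x + \int[mu]_(x in D) f1 x)%E.
  rewrite -!ge0_integralD//.
  apply: eq_integral => x /set_mem Dx; rewrite funeposE funenegE fE//.
  have b0 := f2ge _ Dx; have /andP[a0 aoo] := f1fin _ Dx.
  case: (f1 x) a0 aoo => [a| |]// _ _; case: (f2 x) b0 => [b| |]// _.
    rewrite -EFinB -EFinN -!EFin_max -!EFinD; congr EFin.
    by rewrite /Num.max; do 2 case: ifPn; lra.
  by rewrite addeNy/= max_r ?leNye// max_l ?leey.
rewrite integralE; move: key ple If1.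
have := integral_ge0 mu ppos; have := integral_ge0 mu npos.
have := integral_ge0 mu f1ge; have := integral_ge0 mu f2ge.
move: (integral mu D f1) (integral mu D f2) (integral mu D (f^\+)%E)
  (integral mu D (f^\-)%E).
move=> [a| |] [b| |] [p| |] [n| |] //= _ _ _ _ + + // => [[e] _ _].
by rewrite -!EFinD; congr EFin; lra.
Qed.

(** * Tonelli on rectangles, and doubly periodic integrands on a square *)

Section rectangle.
Variable R : realType.
Local Notation mu := (@lebesgue_measure R).
Implicit Types (A B : set R) (f : R * R -> \bar R).

Lemma ge0_integral_setX1 A B f : measurable A -> measurable B ->
  measurable_fun setT f -> (forall x, 0 <= f x)%E ->
  (\int[(mu \x mu)%E]_(p in A `*` B) f p =
   \int[mu]_(x in A) \int[mu]_(y in B) f (x, y))%E.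
Proof.
move=> mA mB mf f0.
have mAB : measurable (A `*` B) by exact: measurableX.
rewrite integral_mkcond fubini_tonelli1; last 2 first.
- by apply/(measurable_restrictT _ _).1 => //; exact: measurable_funTS.
- by move=> x; exact: erestrict_ge0.
rewrite [RHS]integral_mkcond; apply: eq_integral => x _.
rewrite /fubini_F [RHS]patchE; case: ifPn => xA.
  rewrite [RHS]integral_mkcond; apply: eq_integral => y _.
  by rewrite !patchE; congr (if _ then _ else _); rewrite in_setX xA.
rewrite -[RHS](integral0 mu setT); apply: eq_integral => y _.
by rewrite patchE in_setX (negbTE xA).
Qed.

Lemma ge0_integral_setX2 A B f : measurable A -> measurable B ->
  measurable_fun setT f -> (forall x, 0 <= f x)%E ->
  (\int[(mu \x mu)%E]_(p in A `*` B) f p =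
   \int[mu]_(y in B) \int[mu]_(x in A) f (x, y))%E.
Proof.
move=> mA mB mf f0.
have mAB : measurable (A `*` B) by exact: measurableX.
rewrite integral_mkcond fubini_tonelli2; last 2 first.
- by apply/(measurable_restrictT _ _).1 => //; exact: measurable_funTS.
- by move=> x; exact: erestrict_ge0.
rewrite [RHS]integral_mkcond; apply: eq_integral => y _.
rewrite /fubini_G [RHS]patchE; case: ifPn => yB.
  rewrite [RHS]integral_mkcond; apply: eq_integral => x _.
  by rewrite !patchE; congr (if _ then _ else _); rewrite in_setX yB andbT.
rewrite -[RHS](integral0 mu setT); apply: eq_integral => x _.
by rewrite patchE in_setX (negbTE yB) andbF.
Qed.

Lemma measurable_fun_shift_snd f (a : R) : measurable_fun setT f ->
  measurable_fun setT (fun p : R * R => f (p.1, p.2 + a)).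
Proof.
move=> mf; apply: (measurableT_comp mf).
apply: measurable_fun_pair; first exact: measurable_fst.
exact: (measurableT_comp (measurable_shift a) measurable_snd).
Qed.

Lemma measurable_fun_shift_fst f (a : R) : measurable_fun setT f ->
  measurable_fun setT (fun p : R * R => f (p.1 + a, p.2)).
Proof.
move=> mf; apply: (measurableT_comp mf).
apply: measurable_fun_pair; last exact: measurable_snd.
exact: (measurableT_comp (measurable_shift a) measurable_fst).
Qed.

Lemma ge0_integral_square_shift_snd (p a : R) f : 0 <= a <= p ->
  measurable_fun setT f -> (forall x, 0 <= f x)%E ->
  (forall x y, f (x, y + p) = f (x, y)) ->
  (\int[(mu \x mu)%E]_(z in `[0%R, p] `*` `[0%R, p]) f (z.1, z.2 + a)%R =
   \int[(mu \x mu)%E]_(z in `[0%R, p] `*` `[0%R, p]) f z)%E.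
Proof.
move=> ap mf f0 fp.
rewrite !ge0_integral_setX1//=; last exact: measurable_fun_shift_snd.
apply: eq_integral => x _.
rewrite (@ge0_integral_periodic_shift _ p a (fun y => f (x, y)))//.
exact: measurableT_comp.
Qed.

Lemma ge0_integral_square_shift_fst (p a : R) f : 0 <= a <= p ->
  measurable_fun setT f -> (forall x, 0 <= f x)%E ->
  (forall x y, f (x + p, y) = f (x, y)) ->
  (\int[(mu \x mu)%E]_(z in `[0%R, p] `*` `[0%R, p]) f (z.1 + a, z.2)%R =
   \int[(mu \x mu)%E]_(z in `[0%R, p] `*` `[0%R, p]) f z)%E.
Proof.
move=> ap mf f0 fp.
rewrite !ge0_integral_setX2//=; last exact: measurable_fun_shift_fst.
apply: eq_integral => y _.
rewrite (@ge0_integral_periodic_shift _ p a (fun x => f (x, y)))//.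
exact: measurableT_comp.
Qed.

(** By evenness and periodicity h (x - y) = h (y + (p - x)) with p - x in [0, p], so the inner
    integral over y does not depend on x. *)
Lemma ge0_integral_square_convolution (p : R) (h : R -> \bar R) : 0 <= p ->
  measurable_fun setT h -> (forall x, 0 <= h x)%E ->
  (forall x, h (x + p) = h x) -> (forall x, h (- x) = h x) ->
  (\int[(mu \x mu)%E]_(z in `[0%R, p] `*` `[0%R, p]) h (z.1 - z.2)%R =
   p%:E * \int[mu]_(x in `[0%R, p]) h x)%E.
Proof.
move=> p0 mh h0 hp hN.
have px (x : R) : 0 <= x -> x <= p -> 0 <= p - x <= p by lra.
have shiftE (x y : R) : h (x - y) = h (y + (p - x)).
  by rewrite -hN opprB addrCA addrC hp.
have md : measurable_fun setT (fun z : R * R => z.1 - z.2).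
  by apply: measurable_funB; [exact: measurable_fst|exact: measurable_snd].
rewrite (@ge0_integral_setX1 _ _ (fun z => h (z.1 - z.2)))//=; last first.
  exact: (measurableT_comp mh md).
transitivity
  (\int[mu]_(x in `[0%R, p]) (cst (\int[mu]_(y in `[0%R, p]) h y)) x)%E.
  apply: eq_integral => x /set_mem/=; rewrite in_itv/= => /andP[x0 xp].
  rewrite -[RHS](@ge0_integral_periodic_shift _ p (p - x) h)//; last exact: px.
  by apply: eq_integral => y _; rewrite shiftE.
rewrite integral_cst//= muleC; congr (_ * _)%E.
rewrite lebesgue_measure_itv/= lte_fin; case: ltgtP p0 => //= [_ _|<-] //.
by rewrite -EFinD subr0.
Qed.

End rectangle.

(** * Distances on the circle and continuity of its parametrisation *)

Section circle.
Variable R : realType.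
Implicit Types (t s u : R) (z w : R[i]^o) (g : R[i]^o -> R[i]^o).

Lemma cdistE z w :
  cdist z w = Num.sqrt ((complex.Re z - complex.Re w) ^+ 2 +
                        (complex.Im z - complex.Im w) ^+ 2).
Proof. by case: z w => [a b] [c d]. Qed.

Lemma cdist_ge0 z w : 0 <= cdist z w.
Proof. by rewrite cdistE sqrtr_ge0. Qed.

Lemma cdistC z w : cdist z w = cdist w z.
Proof. by rewrite !cdistE -[X in X + _]sqrrN -[X in _ + X]sqrrN !opprB. Qed.

Lemma cdist_eq0 z w : (cdist z w == 0) = (z == w).
Proof.
apply/eqP/eqP => [/Normc.eq0_normc/eqP|->].
  by rewrite subr_eq0 => /eqP.
by rewrite cdistE !subrr expr0n/= addr0 sqrtr0.
Qed.

Lemma unit_circle_cdist_le2 z w :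
  unit_circle R z -> unit_circle R w -> cdist z w <= 2.
Proof.
rewrite /unit_circle/= /cdist !subr0 => z1 w1.
by rewrite (le_trans (@le_normcD R _ _))// normcN z1 w1.
Qed.

Lemma unit_circle_expi t : unit_circle R (expi t).
Proof. by rewrite /unit_circle/= cdistE/= !subr0 cos2Dsin2 sqrtr1. Qed.

Lemma expiD2pi t : expi (t + 2 * pi) = expi t.
Proof.
by rewrite /expi mulr_natl cosD sinD cos2pi sin2pi !mulr1 !mulr0 subr0 addr0.
Qed.

Lemma expiDpi t : expi (t + pi) = - expi t.
Proof. by rewrite /expi cosDpi sinDpi. Qed.

Lemma cdist_expi t s : cdist (expi t) (expi s) = Num.sqrt (2 - 2 * cos (t - s)).
Proof.
rewrite cdistE/=; congr Num.sqrt; rewrite cosB.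
have := cos2Dsin2 t; have := cos2Dsin2 s; lra.
Qed.

Lemma expi_eq_cos t s : expi t = expi s -> cos (t - s) = 1.
Proof. by rewrite cosB => -[-> ->]; rewrite -!expr2 cos2Dsin2. Qed.

Lemma continuous_expi : continuous (@expi R).
Proof.
(* The radius is a positive element of R[i], hence a positive real; a / 2 for each coordinate
   suffices because 2 (a / 2)^2 < a^2. *)
move=> t; apply/cvgrPdist_lt => -[a b] /=; rewrite ltcE/= => /andP[/eqP ->{b} a0].
have a20 : 0 < a / 2 by rewrite divr_gt0.
have cc := @continuous_cos R t; have cs := @continuous_sin R t.
move/cvgrPdist_lt : cc => /(_ _ a20) cc.
move/cvgrPdist_lt : cs => /(_ _ a20) cs.
near=> s.
rewrite normc_def ltcE/= eqxx/=.
have c1 : `|cos t - cos s| < a / 2 by near: s.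
have s1 : `|sin t - sin s| < a / 2 by near: s.
rewrite -(ltr_pXn2r (n := 2)) ?nnegrE ?sqrtr_ge0 ?(ltW a0)//.
rewrite sqr_sqrtr ?addr_ge0 ?sqr_ge0//.
rewrite -[X in X + _]real_normK ?num_real// -[X in _ + X]real_normK ?num_real//.
have := normr_ge0 (cos t - cos s); have := normr_ge0 (sin t - sin s).
by nra.
Unshelve. all: by end_near. Qed.

Lemma continuous_Re : continuous (@complex.Re R : R[i]^o -> R).
Proof.
move=> z; apply/(@cvgrPdist_lt _ R _ (nbhs (z : R[i]^o))) => a a0.
have a0C : 0 < a%:C%C by rewrite ltcE/= eqxx.
have H := (@cvgrPdist_lt _ R[i]^o _ (nbhs (z : R[i]^o))
  (@nbhs_filter R[i]^o z) id z).1 cvg_id _ a0C.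
move: H; apply: filterS => w /=.
rewrite normc_def ltcE/= => /andP[_]; apply: le_lt_trans.
case: z => zr zi; case: w => wr wi/=.
by rewrite -sqrtr_sqr ler_wsqrtr// lerDl sqr_ge0.
Qed.

Lemma continuous_Im : continuous (@complex.Im R : R[i]^o -> R).
Proof.
move=> z; apply/(@cvgrPdist_lt _ R _ (nbhs (z : R[i]^o))) => a a0.
have a0C : 0 < a%:C%C by rewrite ltcE/= eqxx.
have H := (@cvgrPdist_lt _ R[i]^o _ (nbhs (z : R[i]^o))
  (@nbhs_filter R[i]^o z) id z).1 cvg_id _ a0C.
move: H; apply: filterS => w /=.
rewrite normc_def ltcE/= => /andP[_]; apply: le_lt_trans.
case: z => zr zi; case: w => wr wi/=.
by rewrite -sqrtr_sqr ler_wsqrtr// lerDr sqr_ge0.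
Qed.

(** Relative continuity is enough because [expi] never leaves the circle. *)
Lemma continuous_circle_path g : {within unit_circle R, continuous g} ->
  continuous (g \o @expi R).
Proof.
move=> /subspace_continuousP cg t.
have := cg _ (unit_circle_expi t).
apply: cvg_comp => A /= nA.
near=> s => //.
have : unit_circle R (expi s) -> A (expi s).
  by near: s; exact: (continuous_expi nA).
by apply; exact: unit_circle_expi.
Unshelve. all: by end_near. Qed.

Definition arc_dist g t s := cdist (g (expi t)) (g (expi s)).

Lemma arc_distC g t s : arc_dist g t s = arc_dist g s t.
Proof. exact: cdistC. Qed.

Lemma arc_distE g t s : arc_dist g t s = Num.sqrt
   ((complex.Re (g (expi t)) - complex.Re (g (expi s))) ^+ 2 +
    (complex.Im (g (expi t)) - complex.Im (g (expi s))) ^+ 2).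
Proof. exact: cdistE. Qed.

Section continuous_map.
Variable g : R[i]^o -> R[i]^o.
Hypothesis cg : {within unit_circle R, continuous g}.

Let X t := complex.Re (g (expi t)).
Let Y t := complex.Im (g (expi t)).

Let cX : continuous X.
Proof.
move=> t; apply: (@continuous_comp _ _ _ (g \o @expi R)).
  exact: (continuous_circle_path cg).
exact: continuous_Re.
Qed.

Let cY : continuous Y.
Proof.
move=> t; apply: (@continuous_comp _ _ _ (g \o @expi R)).
  exact: (continuous_circle_path cg).
exact: continuous_Im.
Qed.

Lemma continuous_arc_dist : continuous (fun p : R * R => arc_dist g p.1 p.2).
Proof.
move=> p; under eq_fun do rewrite arc_distE.
have c1 (f : R -> R) : continuous f ->
    {for p, continuous (fun p : R * R => f p.1)}.
  by move=> cf; apply: (@continuous_comp _ _ _ fst f); [exact: cvg_fst|exact: cf].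
have c2 (f : R -> R) : continuous f ->
    {for p, continuous (fun p : R * R => f p.2)}.
  by move=> cf; apply: (@continuous_comp _ _ _ snd f); [exact: cvg_snd|exact: cf].
pose F := fun p : R * R => (X p.1 - X p.2) ^+ 2 + (Y p.1 - Y p.2) ^+ 2.
have cF : {for p, continuous F}.
  have dX := continuousB (c1 _ cX) (c2 _ cX).
  have dY := continuousB (c1 _ cY) (c2 _ cY).
  exact: (continuousD (continuousM dX dX) (continuousM dY dY)).
exact: (@continuous_comp _ _ _ F (@Num.sqrt R) p cF (@sqrt_continuous R _)).
Qed.

Lemma measurable_arc_dist :
  measurable_fun setT (fun p : R * R => arc_dist g p.1 p.2).
Proof.
under eq_fun do rewrite arc_distE.
have m1 (f : R -> R) : continuous f ->
    measurable_fun setT (fun p : R * R => f p.1).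
  move=> /continuous_measurable_fun mf.
  exact: (measurableT_comp mf measurable_fst).
have m2 (f : R -> R) : continuous f ->
    measurable_fun setT (fun p : R * R => f p.2).
  move=> /continuous_measurable_fun mf.
  exact: (measurableT_comp mf measurable_snd).
have ms : measurable_fun setT (@Num.sqrt R).
  by apply: continuous_measurable_fun; exact: sqrt_continuous.
have mX := measurable_funB (m1 _ cX) (m2 _ cX).
have mY := measurable_funB (m1 _ cY) (m2 _ cY).
apply: (measurableT_comp ms).
exact: (measurable_funD (measurable_funX 2 mX) (measurable_funX 2 mY)).
Qed.

End continuous_map.

Lemma circle_homeo_id : circle_homeo (id : R[i]^o -> R[i]^o).
Proof.
by exists id; split => //; apply: continuous_subspaceT => x; exact: cvg_id.
Qed.

End circle.

(** * Splitting the energy into two nonnegative kernels *)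

Section kernels.
Variable R : realType.
Local Notation mu := (@lebesgue_measure R).
Implicit Types (t s u : R) (g : R[i]^o -> R[i]^o).

Definition cosp u : R := Num.max (cos u) 0.
Definition cosn u : R := Num.max (- cos u) 0.

Lemma cosp_ge0 u : 0 <= cosp u. Proof. by rewrite le_max lexx orbT. Qed.
Lemma cosn_ge0 u : 0 <= cosn u. Proof. by rewrite le_max lexx orbT. Qed.
Lemma cosp_le1 u : cosp u <= 1. Proof. by rewrite ge_max cos_le1 ler01. Qed.
Lemma cosn_le1 u : cosn u <= 1.
Proof. by rewrite ge_max ler01 lerNl cos_geN1. Qed.

Lemma cospBcosn u : cos u = cosp u - cosn u.
Proof. by rewrite /cosp /cosn /Num.max; do 2 case: ifPn; lra. Qed.

Lemma cosBpi u : cos (u - pi) = - cos u.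
Proof. by rewrite -[u in RHS](subrK pi) cosDpi opprK. Qed.

(** A half-turn of one argument exchanges the two parts of the cosine; this is how terms of [kerA]
    at antipodal points come to carry the same weights as terms of [kerB]. *)
Lemma cospDpi u : cosp (u + pi) = cosn u.
Proof. by rewrite /cosp /cosn cosDpi. Qed.

Lemma cosnDpi u : cosn (u + pi) = cosp u.
Proof. by rewrite /cosp /cosn cosDpi opprK. Qed.

Lemma cospBpi u : cosp (u - pi) = cosn u.
Proof. by rewrite /cosp /cosn cosBpi. Qed.

Lemma cosnBpi u : cosn (u - pi) = cosp u.
Proof. by rewrite /cosp /cosn cosBpi opprK. Qed.

Lemma cosD2pi u : cos (u + 2 * pi) = cos u.
Proof. by rewrite mulr_natl cosD cos2pi sin2pi mulr1 mulr0 subr0. Qed.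

Lemma cosB2pi u : cos (u - 2 * pi) = cos u.
Proof. by rewrite -[in RHS](subrK (2 * pi) u) cosD2pi. Qed.

Lemma measurable_cos : measurable_fun setT (@cos R).
Proof. by apply: continuous_measurable_fun; exact: continuous_cos. Qed.

Lemma measurable_cosp : measurable_fun setT cosp.
Proof.
by apply: measurable_maxr; [exact: measurable_cos|exact: measurable_cst].
Qed.

Lemma measurable_cosn : measurable_fun setT cosn.
Proof.
apply: measurable_maxr; last exact: measurable_cst.
by apply: measurable_funN; exact: measurable_cos.
Qed.

Lemma measurable_lne_EFin : measurable_fun setT (fun x : R => lne x%:E).
Proof.
rewrite (_ : (fun _ => _) = fun x : R => if x <= 0 then -oo%E else (ln x)%:E)//.
apply: measurable_fun_ifT => //.
- by apply: measurable_fun_ler.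
- by apply/measurable_EFinP; exact: measurable_ln.
Qed.

Lemma measurable_arc : measurable_fun setT (fun p : R * R => p.1 - p.2).
Proof.
by apply: measurable_funB; [exact: measurable_fst|exact: measurable_snd].
Qed.

(* The shift by ln 2, the logarithm of the diameter, makes logdist
   nonnegative; the integrand of the energy is then the difference kerA - kerB
   of nonnegative functions, of which kerA is bounded. *)
Definition logdist g t s : \bar R := ((ln 2)%:E - lne (arc_dist g t s)%:E)%E.

Definition kerA g (p : R * R) : \bar R :=
  ((ln 2 * cosp (p.1 - p.2))%:E + logdist g p.1 p.2 * (cosn (p.1 - p.2))%:E)%E.

Definition kerB g (p : R * R) : \bar R :=
  (logdist g p.1 p.2 * (cosp (p.1 - p.2))%:E + (ln 2 * cosn (p.1 - p.2))%:E)%E.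

Section fixed_map.
Variable g : R[i]^o -> R[i]^o.
Hypothesis hg : circle_homeo g.

Lemma circle_homeo_continuous : {within unit_circle R, continuous g}.
Proof. by case: hg => h []. Qed.

Lemma arc_dist_le2 t s : arc_dist g t s <= 2.
Proof.
case: hg => h [gu _ _ _]; apply: unit_circle_cdist_le2.
- exact: (gu _ (unit_circle_expi t)).1.
- exact: (gu _ (unit_circle_expi s)).1.
Qed.

Lemma arc_dist_eq0 t s : (arc_dist g t s == 0) = (expi t == expi s).
Proof.
rewrite cdist_eq0; apply/eqP/eqP => [e|-> //].
case: hg => h [gu _ _ _].
by rewrite -(gu _ (unit_circle_expi t)).2 e (gu _ (unit_circle_expi s)).2.
Qed.

Lemma arc_dist_gt0 t s : cos (t - s) != 1 -> 0 < arc_dist g t s.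
Proof.
move=> cts; rewrite lt_neqAle cdist_ge0 andbT eq_sym arc_dist_eq0.
by apply: contra cts => /eqP/expi_eq_cos ->.
Qed.

(** Adding [cosp] makes the function positive on the whole compact square: where the distance
    vanishes, the cosine is 1. Its minimum then bounds the distance wherever the cosine is
    nonpositive, since the added term is 0 there. *)
Lemma arc_dist_lower_bound : exists2 m : R, 0 < m &
  forall t s, t \in `[0, 2 * pi] -> s \in `[0, 2 * pi] -> cos (t - s) <= 0 ->
    m <= arc_dist g t s.
Proof.
pose F := fun p : R * R => arc_dist g p.1 p.2 + cosp (p.1 - p.2).
have cF : continuous F.
  move=> p.
  have cd : {for p, continuous (fun q : R * R => arc_dist g q.1 q.2)}.
    by apply: continuous_arc_dist; exact: circle_homeo_continuous.
  have cB : {for p, continuous (fun q : R * R => q.1 - q.2)}.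
    by apply: continuousB; [exact: cvg_fst|exact: cvg_snd].
  have cM : {for p.1 - p.2, continuous cosp}.
    by apply: continuous_max; [exact: continuous_cos|exact: cvg_cst].
  exact: (continuousD cd (@continuous_comp _ _ _
    (fun q : R * R => q.1 - q.2) cosp p cB cM)).
have K0 : (`[0, 2 * pi] `*` `[0, 2 * pi] : set (R * R)) !=set0.
  exists (0, 0); split => /=; rewrite in_itv/= lexx/= mulr_ge0// pi_ge0//.
have Kc : compact (`[0, 2 * pi] `*` `[0, 2 * pi] : set (R * R)).
  by apply: compact_setX; exact: segment_compact.
have [c cK cmin] := compact_EVT_min K0 Kc (continuous_subspaceT cF).
exists (F c).
  rewrite /F; have [e|ne] := eqVneq (arc_dist g c.1 c.2) 0; last first.
    by rewrite ltr_pwDl ?cosp_ge0// lt_neqAle eq_sym ne cdist_ge0.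
  move/eqP : e (e); rewrite arc_dist_eq0 => /eqP/expi_eq_cos c1 ->.
  by rewrite add0r /cosp c1 lt_max ltr01.
move=> t s tT sT cts.
have := cmin (t, s); rewrite /F/= {2}/cosp (max_r cts) addr0; apply.
by rewrite inE; split.
Qed.

Lemma logdist_ge0 t s : (0 <= logdist g t s)%E.
Proof.
rewrite /logdist; have [d0|d0] := leP (arc_dist g t s) 0.
  by rewrite le0_lneNy ?lee_fin//= leey.
by rewrite lne_EFin// lee_fin subr_ge0 ler_ln ?posrE// arc_dist_le2.
Qed.

Lemma ln2_ge0 : 0 <= ln 2 :> R. Proof. by rewrite ln_ge0// ler1n. Qed.

Lemma kerA_ge0 p : (0 <= kerA g p)%E.
Proof.
rewrite adde_ge0//; first by rewrite lee_fin mulr_ge0 ?ln2_ge0 ?cosp_ge0.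
by rewrite mule_ge0 ?logdist_ge0// lee_fin cosn_ge0.
Qed.

Lemma kerB_ge0 p : (0 <= kerB g p)%E.
Proof.
rewrite adde_ge0//; last by rewrite lee_fin mulr_ge0 ?ln2_ge0 ?cosn_ge0.
by rewrite mule_ge0 ?logdist_ge0// lee_fin cosp_ge0.
Qed.

Lemma measurable_logdist : measurable_fun setT (fun p => logdist g p.1 p.2).
Proof.
apply: emeasurable_funB => //.
have := measurable_arc_dist circle_homeo_continuous.
exact: (measurableT_comp measurable_lne_EFin).
Qed.

Lemma measurable_kerA : measurable_fun setT (kerA g).
Proof.
apply: emeasurable_funD.
  apply/measurable_EFinP; apply: measurable_funM => //.
  exact: (measurableT_comp measurable_cosp measurable_arc).
apply: emeasurable_funM; first exact: measurable_logdist.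
apply/measurable_EFinP; exact: (measurableT_comp measurable_cosn measurable_arc).
Qed.

Lemma measurable_kerB : measurable_fun setT (kerB g).
Proof.
apply: emeasurable_funD; last first.
  apply/measurable_EFinP; apply: measurable_funM => //.
  exact: (measurableT_comp measurable_cosn measurable_arc).
apply: emeasurable_funM; first exact: measurable_logdist.
apply/measurable_EFinP; exact: (measurableT_comp measurable_cosp measurable_arc).
Qed.

Lemma arc_distD2pi t s : arc_dist g (t + 2 * pi) s = arc_dist g t s.
Proof. by rewrite /arc_dist expiD2pi. Qed.

Lemma arc_distrD2pi t s : arc_dist g t (s + 2 * pi) = arc_dist g t s.
Proof. by rewrite /arc_dist expiD2pi. Qed.

Lemma kerA_fst2pi t s : kerA g (t + 2 * pi, s) = kerA g (t, s).
Proof.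
by rewrite /kerA/= /logdist arc_distD2pi addrAC /cosp /cosn cosD2pi.
Qed.

Lemma kerA_snd2pi t s : kerA g (t, s + 2 * pi) = kerA g (t, s).
Proof.
by rewrite /kerA/= /logdist arc_distrD2pi opprD addrA /cosp /cosn cosB2pi.
Qed.

Lemma kerB_fst2pi t s : kerB g (t + 2 * pi, s) = kerB g (t, s).
Proof.
by rewrite /kerB/= /logdist arc_distD2pi addrAC /cosp /cosn cosD2pi.
Qed.

Lemma kerB_snd2pi t s : kerB g (t, s + 2 * pi) = kerB g (t, s).
Proof.
by rewrite /kerB/= /logdist arc_distrD2pi opprD addrA /cosp /cosn cosB2pi.
Qed.

(** This is (ln 2 - [logdist]) ([cosp] - [cosn]) expanded and sorted by sign. On the diagonal [kerA]
    is ln 2 and [kerB] is +oo, so both sides are -oo. *)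
Lemma integrand_kerAB t s :
  (lne (arc_dist g t s)%:E * (cos (t - s))%:E =
   kerA g (t, s) - kerB g (t, s))%E.
Proof.
rewrite /kerA /kerB /= /logdist.
have [/eqP|d0] := eqVneq (arc_dist g t s) 0.
  move=> e; rewrite (eqP e) le0_lneNy//.
  move: e; rewrite arc_dist_eq0 => /eqP/expi_eq_cos c1.
  rewrite /cosp /cosn c1 max_l// max_r ?lerN10// !mule1 mule0 mulr0 mulr1.
  by rewrite /= adde0.
have {}d0 : 0 < arc_dist g t s by rewrite lt_neqAle eq_sym d0 cdist_ge0.
rewrite lne_EFin// -!(EFinM, EFinD, EFinN) cospBcosn; congr EFin; ring.
Qed.

Local Notation T := (`[0%R, (2 * @pi R)%R]%classic).

Lemma kerA_bounded : exists2 M : R, 0 <= M &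
  forall p, (T `*` T) p -> (kerA g p <= M%:E)%E.
Proof.
have [m m0 mle] := arc_dist_lower_bound.
exists (ln 2 + `|ln 2 - ln m|); first by rewrite addr_ge0 ?ln2_ge0.
move=> [t s] [/= tT sT]; rewrite /kerA/= EFinD; apply: leeD.
  by rewrite lee_fin ler_piMr ?ln2_ge0 ?cosp_le1.
(* [cosn] removes the logarithm unless the cosine is nonpositive, which is exactly where the lower
   bound m holds. *)
have [c0|c0] := leP (cos (t - s)) 0; last first.
  by rewrite /cosn max_r ?oppr_le0 ?(ltW c0)// mule0 lee_fin.
have d0 := lt_le_trans m0 (mle _ _ tT sT c0).
rewrite /logdist lne_EFin// -EFinB -EFinM lee_fin.
rewrite (@le_trans _ _ (ln 2 - ln (arc_dist g t s)))//.
  by rewrite ler_piMr ?cosn_le1// subr_ge0 ler_ln ?posrE// arc_dist_le2.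
rewrite (le_trans _ (ler_norm _))// lerD2l lerN2 ler_ln ?posrE//.
exact: mle.
Qed.

Definition intA := (\int[(mu \x mu)%E]_(p in T `*` T) kerA g p)%E.
Definition intB := (\int[(mu \x mu)%E]_(p in T `*` T) kerB g p)%E.

Lemma pi2_ge0 : 0 <= 2 * pi :> R.
Proof. by rewrite mulr_ge0// pi_ge0. Qed.

Lemma lebesgue_measure_period : mu T = (2 * pi)%:E.
Proof.
rewrite lebesgue_measure_itv/= lte_fin mulr_gt0 ?pi_gt0//.
by rewrite -EFinD subr0.
Qed.

Lemma measurable_square : measurable (T `*` T).
Proof. by apply: measurableX. Qed.

Lemma intA_fin_num : intA \is a fin_num.
Proof.
rewrite ge0_fin_numE; last by apply: integral_ge0 => p _; exact: kerA_ge0.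
have [M M0 AM] := kerA_bounded.
apply: (@le_lt_trans _ _ (\int[(mu \x mu)%E]_(p in T `*` T) (cst M%:E p))%E).
  apply: ge0_le_integral => //.
  - exact: measurable_square.
  - by move=> p _; exact: kerA_ge0.
  - by apply: measurable_funTS; exact: measurable_kerA.
rewrite (@ge0_integral_setX1 _ _ _ (cst M%:E))//.
rewrite (eq_integral (cst (M * (2 * pi))%:E)); last first.
  by move=> x _; rewrite (integral_cst mu)//= lebesgue_measure_period.
by rewrite (integral_cst mu)//= lebesgue_measure_period -EFinM ltry.
Qed.

(** The minus sign in the energy reverses the difference. [intB] may be +oo; the finiteness of
    [intA] keeps the difference defined. *)
Lemma energyE : energy g = (((2 * pi ^+ 2)^-1)%:E * (intB - intA))%E.
Proof.
rewrite /energy (@ge0_integral_difference _ _ _ (mu \x mu)%E (T `*` T) _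
  (kerA g) (kerB g)).
- rewrite -/intA -/intB EFinN mulNe -muleN oppeB; last first.
    by rewrite fin_num_adde_defr// intA_fin_num.
  by rewrite addeC.
- exact: measurable_square.
- by apply: measurable_funTS; exact: measurable_kerA.
- by apply: measurable_funTS; exact: measurable_kerB.
- move=> p pT; rewrite kerA_ge0/=; have [M _ AM] := kerA_bounded.
  by rewrite (le_lt_trans (AM _ pT))// ltry.
- by move=> p _; exact: kerB_ge0.
- by move=> [t s] _; exact: integrand_kerAB.
- rewrite -ge0_fin_numE ?intA_fin_num// integral_ge0// => p _.
  exact: kerA_ge0.
Qed.

Lemma pi_period : 0 <= @pi R <= 2 * @pi R.
Proof. by have := @pi_ge0 R; lra. Qed.

Lemma intA_shift_fst :
  (\int[(mu \x mu)%E]_(p in T `*` T) kerA g (p.1 + pi, p.2)%R)%E = intA.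
Proof.
apply: ge0_integral_square_shift_fst; [exact: pi_period|exact: measurable_kerA|
  exact: kerA_ge0|exact: kerA_fst2pi].
Qed.

Lemma intA_shift_snd :
  (\int[(mu \x mu)%E]_(p in T `*` T) kerA g (p.1, p.2 + pi)%R)%E = intA.
Proof.
apply: ge0_integral_square_shift_snd; [exact: pi_period|exact: measurable_kerA|
  exact: kerA_ge0|exact: kerA_snd2pi].
Qed.

Lemma intB_shift :
  (\int[(mu \x mu)%E]_(p in T `*` T) kerB g (p.1 + pi, p.2 + pi)%R)%E = intB.
Proof.
rewrite (@ge0_integral_square_shift_fst _ (2 * pi) pi
  (fun p => kerB g (p.1, p.2 + pi)))//=.
- by apply: ge0_integral_square_shift_snd; [exact: pi_period|
    exact: measurable_kerB|exact: kerB_ge0|exact: kerB_snd2pi].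
- exact: pi_period.
- by apply: measurable_fun_shift_snd; exact: measurable_kerB.
- by move=> p; exact: kerB_ge0.
- by move=> x y; exact: kerB_fst2pi.
Qed.

End fixed_map.

End kernels.

(** * Cross-ratios of inscribed rectangles and the upper bound *)

Section rectangles.
Variable R : realType.
Local Notation mu := (@lebesgue_measure R).
Local Notation T := (`[0%R, (2 * @pi R)%R]%classic).
Implicit Types (t s u c : R) (g : R[i]^o -> R[i]^o) (eta : \bar R -> \bar R).

(* For c = cos (t - s), this is the cross-ratio of the rectangle e^{it},
   -e^{is}, e^{is}, -e^{it}. The maxima extend it to a monotone function on
   the whole line. *)
Definition rect_ratio c : \bar R :=
  ((Num.max (2 + 2 * c) 0)%:E / (Num.max (2 - 2 * c) 0)%:E)%E.

Lemma rect_ratio_ge0 c : (0 <= rect_ratio c)%E.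
Proof. by rewrite mule_ge0 ?inve_ge0 ?lee_fin ?le_max ?lexx ?orbT. Qed.

Lemma rect_ratio_nd : {homo rect_ratio : x y / x <= y >-> (x <= y)%E}.
Proof.
move=> x y xy; rewrite /rect_ratio; apply: lee_pmul.
- by rewrite lee_fin le_max lexx orbT.
- by rewrite inve_ge0 lee_fin le_max lexx orbT.
- by rewrite lee_fin /Num.max; do 2 case: ifPn; lra.
- rewrite lee_pV2 ?lee_fin; [|by rewrite inE lee_fin le_max lexx orbT..].
  by rewrite /Num.max; do 2 case: ifPn; lra.
Qed.

Lemma rect_ratio_lt1 c : -1 <= c -> c < 1 ->
  rect_ratio c = ((2 + 2 * c) / (2 - 2 * c))%:E.
Proof.
move=> c1 c2; rewrite /rect_ratio !max_l; [|lra..].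
by rewrite inver ifF; [|apply/eqP; lra].
Qed.

Lemma rect_ratio_cos u :
  rect_ratio (cos u) = ((2 + 2 * cos u)%:E / (2 - 2 * cos u)%:E)%E.
Proof.
by rewrite /rect_ratio !max_l//; have := cos_le1 u; have := cos_geN1 u; lra.
Qed.

Definition rect_cross_ratio g t s : \bar R :=
  cross_ratio (g (expi t)) (g (expi (s + pi))) (g (expi s)) (g (expi (t + pi))).

(** Opposite sides of the rectangle have equal length, so each product of distances is the square of
    a square root. *)
Lemma rect_cross_ratio_id t s :
  rect_cross_ratio id t s = rect_ratio (cos (t - s)).
Proof.
rewrite rect_ratio_cos /rect_cross_ratio /cross_ratio !cdist_expi.
rewrite (_ : t - (s + pi) = t - s - pi); last ring.
rewrite (_ : s - (t + pi) = - (t - s + pi)); last ring.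
rewrite (_ : s + pi - (t + pi) = - (t - s)); last ring.
rewrite !cosN cosDpi cosBpi -!expr2 !sqr_sqrtr ?mulrN ?opprK//.
Qed.

Section energy_identity.
Variable g : R[i]^o -> R[i]^o.
Hypothesis hg : circle_homeo g.

(** After the half-turns every [logdist] carries the weight [cosp (t - s)] and the terms in ln 2
    agree on both sides. What remains is the logarithm of a quotient of four distances. *)
Lemma kerB_rectangle t s :
  (kerB g (t, s) + kerB g (t + pi, s + pi)%R =
   kerA g (t, s + pi)%R + kerA g (t + pi, s)%R +
     lne (rect_cross_ratio g t s) * (cosp (t - s))%:E)%E.
Proof.
rewrite /kerA /kerB /=.
rewrite (_ : t + pi - (s + pi) = t - s); last ring.
rewrite (_ : t - (s + pi) = t - s - pi); last ring.
rewrite cospBpi cosnBpi.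
rewrite (_ : t + pi - s = t - s + pi); last ring.
rewrite cospDpi cosnDpi.
have [c0|c0] := leP (cos (t - s)) 0.
  by rewrite [cosp _]max_r// !mule0 !adde0 !add0e.
have p0 : 0 < cosp (t - s) by rewrite lt_max c0.
have d2 : 0 < arc_dist g t (s + pi).
  by rewrite arc_dist_gt0// opprD addrA cosBpi; apply/eqP; lra.
have d3 : 0 < arc_dist g (t + pi) s.
  rewrite arc_dist_gt0// (_ : t + pi - s = t - s + pi); last ring.
  by rewrite cosDpi; apply/eqP; lra.
rewrite /rect_cross_ratio /cross_ratio -!/(arc_dist _ _ _).
rewrite (arc_distC g s) (arc_distC g (s + pi)) /logdist.
rewrite (lne_EFin d2) (lne_EFin d3).
(* If t and s give the same point, so do their antipodes. The denominator of the cross-ratio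
   vanishes while its numerator is positive, and both sides are +oo. *)
have [e|d1] := eqVneq (arc_dist g t s) 0.
  have d4 : arc_dist g (t + pi) (s + pi) = 0.
    move/eqP : e; rewrite arc_dist_eq0// => /eqP e.
    by apply/eqP; rewrite arc_dist_eq0// !expiDpi e.
  rewrite e d4 mulr0 inve0 gt0_muley ?lte_fin ?mulr_gt0// le0_lneNy//.
  rewrite -[lne +oo]/(+oo)%E -[(- -oo)%E]/(+oo)%E addey// gt0_mulye ?lte_fin//.
have {}d1 : 0 < arc_dist g t s by rewrite lt_neqAle eq_sym d1 cdist_ge0.
have d4 : 0 < arc_dist g (t + pi) (s + pi).
  move: d1; rewrite !lt_neqAle !cdist_ge0 !andbT !(eq_sym 0) !arc_dist_eq0//.
  by rewrite !expiDpi eqr_opp.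
rewrite (lne_EFin d1) (lne_EFin d4) inver mulf_eq0 !gt_eqF// -EFinM.
rewrite lne_EFin ?divr_gt0 ?mulr_gt0//.
rewrite ln_div ?posrE ?mulr_gt0// !lnM ?posrE//.
rewrite -!(EFinM, EFinD, EFinN); congr EFin; ring.
Qed.

Lemma intB_double :
  (\int[(mu \x mu)%E]_(p in T `*` T)
     (kerB g (p.1, p.2) + kerB g (p.1 + pi, p.2 + pi)%R) =
   intB g + intB g)%E.
Proof.
have mB := measurable_kerB hg; have B0 := kerB_ge0 hg.
rewrite ge0_integralD//; first last.
- apply: measurable_funTS.
  apply: (measurable_fun_shift_fst pi (f := fun p => kerB g (p.1, p.2 + pi))).
  exact: measurable_fun_shift_snd.
- apply: measurable_funTS; apply: (measurableT_comp mB).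
  exact: measurable_fun_pair.
- exact: measurable_square.
by rewrite intB_shift//; congr (_ + _)%E; apply: eq_integral => -[].
Qed.

Lemma intA_double :
  (\int[(mu \x mu)%E]_(p in T `*` T)
     (kerA g (p.1, p.2 + pi)%R + kerA g (p.1 + pi, p.2)%R) =
   intA g + intA g)%E.
Proof.
have mA := measurable_kerA hg; have A0 := kerA_ge0 hg.
rewrite ge0_integralD//; first last.
- by apply: measurable_funTS; exact: measurable_fun_shift_fst.
- by apply: measurable_funTS; exact: measurable_fun_shift_snd.
- exact: measurable_square.
by rewrite intA_shift_fst// intA_shift_snd.
Qed.

End energy_identity.

(** The even, 2 pi-periodic extension of the integrand of [energy_bound], cut off where the cosine
    is nonpositive. *)
Definition rect_bound eta u : \bar R :=
  (lne (eta (rect_ratio (cos u))) * (cosp u)%:E)%E.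

Section control.
Variable eta : \bar R -> \bar R.
Hypothesis heta : control_function eta.
Hypothesis eta1 : (1 <= eta 1)%E.

Lemma eta_rect_ratio_ge0 c : (0 <= eta (rect_ratio c))%E.
Proof. by case: heta => + _ _ _; apply; exact: rect_ratio_ge0. Qed.

(** Where cos u > 0, the ratio is at least [rect_ratio 0], which is 1, so monotonicity and 1 <=
    [eta 1] make the logarithm nonnegative. *)
Lemma rect_bound_ge0 u : (0 <= rect_bound eta u)%E.
Proof.
rewrite /rect_bound; have [c0|c0] := leP (cos u) 0.
  by rewrite [cosp _]max_r// mule0.
rewrite mule_ge0 ?lee_fin ?cosp_ge0// lne_ge0 (le_trans eta1)//.
case: heta => _ nd _ _; apply: nd => //.
rewrite (le_trans _ (rect_ratio_nd (ltW c0)))//.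
by rewrite rect_ratio_lt1 ?ltr01 ?lerN10// mulr0 addr0 subr0 divff.
Qed.

(** Measurability comes from monotonicity: the logarithmic factor is a nondecreasing function of c =
    cos u on the whole line. *)
Lemma measurable_rect_bound : measurable_fun setT (rect_bound eta).
Proof.
apply: emeasurable_funM; last by apply/measurable_EFinP; exact: measurable_cosp.
apply: (@measurableT_comp _ _ _ _ _ _ (fun c => lne (eta (rect_ratio c)))).
  apply: nondecreasing_emeasurable => x y xy.
  rewrite lee_lne ?in_itv/= ?leey ?eta_rect_ratio_ge0//.
  by case: heta => _ nd _ _; apply: nd (rect_ratio_ge0 _) (rect_ratio_nd xy).
exact: measurable_cos.
Qed.

(** By the half-angle formulas both sides are (1 + cos t) / (1 - cos t). *)
Lemma cot_half_sqr t : 0 < t -> t <= pi / 2 ->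
  (cot (t / 2) ^+ 2)%:E = rect_ratio (cos t).
Proof.
move=> t0 tpi.
have t2 : t = t / 2 + t / 2 by lra.
have s0 : sin (t / 2) != 0.
  by rewrite gt_eqF// sin_gt0_pi//; have := @pi_gt0 R; lra.
have e := cos2Dsin2 (t / 2).
have s20 : 0 < sin (t / 2) ^+ 2 by rewrite exprn_even_gt0.
have ct : cos t = 1 - 2 * sin (t / 2) ^+ 2 by rewrite {1}t2 cosD; lra.
rewrite rect_ratio_lt1; [|exact: cos_geN1|lra].
rewrite /cot expr_div_n ct; congr EFin.
rewrite (_ : cos (t / 2) ^+ 2 = 1 - sin (t / 2) ^+ 2); last lra.
move: (sin (t / 2) ^+ 2) s20 => S S0.
rewrite (_ : 2 - 2 * (1 - 2 * S) = 4 * S); last ring.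
by field; rewrite gt_eqF.
Qed.

Definition rect_bound_integral : \bar R :=
  (\int[mu]_(t in `]0%R, (pi / 2)%R])
     (lne (eta (cot (t / 2) ^+ 2)%R%:E) * (cos t)%:E))%E.

Lemma integral_rect_bound_pi :
  (\int[mu]_(u in `[0%R, pi]) rect_bound eta u)%E = rect_bound_integral.
Proof.
have mH := measurable_rect_bound; have H0 := rect_bound_ge0.
have p0 := @pi_gt0 R.
rewrite -integral_itv_obnd_cbnd; last exact: measurable_funTS.
rewrite (@ge0_integral_itv_split _ 0 (pi / 2))//; [|lra..].
rewrite [X in (_ + X)%E]integral0_eq ?adde0; last first.
  move=> u /=; rewrite in_itv/= => /andP[u1 u2].
  rewrite /rect_bound [cosp _]max_r ?mule0//.
  have := @cos_gt0_pihalf R (pi - u).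
  rewrite -[pi - u]opprB cosN cosBpi.
  have [->|une] := eqVneq u pi; first by rewrite cospi.
  by move=> H; suff: 0 < - cos u by [lra]; apply: H; lra.
apply: eq_integral => u /set_mem/=; rewrite in_itv/= => /andP[u0 u1].
rewrite /rect_bound cot_half_sqr// /cosp max_l//.
by rewrite cos_ge0_pihalf//; lra.
Qed.

Lemma integral_rect_bound :
  (\int[(mu \x mu)%E]_(p in T `*` T) rect_bound eta (p.1 - p.2)%R =
   (2 * pi)%:E * (rect_bound_integral + rect_bound_integral))%E.
Proof.
have mH := measurable_rect_bound; have H0 := rect_bound_ge0.
have hD x : rect_bound eta (x + 2 * pi) = rect_bound eta x.
  by rewrite /rect_bound /cosp cosD2pi.
have hN x : rect_bound eta (- x) = rect_bound eta x.
  by rewrite /rect_bound /cosp cosN.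
rewrite ge0_integral_square_convolution//; last exact: pi2_ge0.
rewrite (@ge0_integral_even_periodic _ (2 * pi) _ _ _ _ _ pi)//.
- by rewrite integral_rect_bound_pi.
- by rewrite mulr_natl mulr2n.
- exact: pi_ge0.
Qed.

Lemma energy_boundE : energy_bound eta = ((pi^-1)%:E * rect_bound_integral)%E.
Proof. by []. Qed.

Lemma rect_bound_integral_ge0 : (0 <= rect_bound_integral)%E.
Proof.
rewrite -integral_rect_bound_pi; apply: integral_ge0 => u _.
exact: rect_bound_ge0.
Qed.

Lemma integral_kerA_rect_bound g : circle_homeo g ->
  (\int[(mu \x mu)%E]_(p in T `*` T)
     (kerA g (p.1, p.2 + pi)%R + kerA g (p.1 + pi, p.2)%R +
      rect_bound eta (p.1 - p.2)%R) =
   intA g + intA g +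
     (2 * pi)%:E * (rect_bound_integral + rect_bound_integral))%E.
Proof.
move=> hg; have mA := measurable_kerA hg; have A0 := kerA_ge0 hg.
have mH := measurable_rect_bound; have H0 := rect_bound_ge0.
rewrite ge0_integralD//.
- by rewrite intA_double// integral_rect_bound.
- exact: measurable_square.
- by move=> p _; rewrite adde_ge0.
- apply: measurable_funTS; apply: emeasurable_funD.
    exact: measurable_fun_shift_snd.
  exact: measurable_fun_shift_fst.
- apply: measurable_funTS; exact: (measurableT_comp mH (@measurable_arc R)).
Qed.

End control.

Lemma quasi_mobius_ge1 eta g : circle_homeo g -> quasi_mobius eta g ->
  (1 <= eta 1)%E.
Proof.
move=> hg qm.
have u0 := unit_circle_expi (0 : R); have u1 := unit_circle_expi (pi : R).
(* The degenerate quadruple 1, -1, -1, 1 has cross-ratio 1. *)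
have := qm _ _ _ _ u0 u1 u1 u0.
have c1 : cos (0 - pi : R) != 1 by rewrite sub0r cosN cospi; apply/eqP; lra.
have c2 : cos (pi - 0 : R) != 1 by rewrite subr0 cospi; apply/eqP; lra.
have crE f : circle_homeo f ->
    cross_ratio (f (expi (0 : R))) (f (expi pi)) (f (expi pi)) (f (expi 0)) =
    1%E.
  move=> hf; rewrite /cross_ratio divee// -/(arc_dist _ _ _) -/(arc_dist _ _ _).
  by rewrite gt_eqF// lte_fin mulr_gt0// arc_dist_gt0.
by rewrite crE// (crE id)//; exact: circle_homeo_id.
Qed.

Lemma energy_le_bound eta g : control_function eta -> circle_homeo g ->
  quasi_mobius eta g -> (energy g <= energy_bound eta)%E.
Proof.
move=> heta hg qm; have eta1 := quasi_mobius_ge1 hg qm.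
have A0 := kerA_ge0 hg; have B0 := kerB_ge0 hg.
have mA := measurable_kerA hg; have mB := measurable_kerB hg.
have mH := measurable_rect_bound heta; have H0 := rect_bound_ge0 heta eta1.
have : (intB g + intB g <= intA g + intA g +
     (2 * pi)%:E * (rect_bound_integral eta + rect_bound_integral eta))%E.
  rewrite -intB_double// -integral_kerA_rect_bound//.
  apply: ge0_le_integral.
  - exact: measurable_square.
  - by move=> p _; rewrite adde_ge0.
  - apply: measurable_funTS; apply: emeasurable_funD.
      by apply: (measurableT_comp mB); exact: measurable_fun_pair.
    apply: (measurable_fun_shift_fst pi (f := fun p => kerB g (p.1, p.2 + pi))).
    exact: measurable_fun_shift_snd.
  - apply: measurable_funTS; apply: emeasurable_funD.
      apply: emeasurable_funD; first exact: measurable_fun_shift_snd.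
      exact: measurable_fun_shift_fst.
    exact: (measurableT_comp mH (@measurable_arc R)).
  (* Only the cross-ratio terms differ; they are compared by the quasi-Möbius inequality for the
     rectangle, [lne] being monotone and [cosp] nonnegative. *)
  - move=> [t s] _; rewrite /= kerB_rectangle// leeD2l//.
    rewrite lee_wpmul2r ?lee_fin ?cosp_ge0//.
    rewrite lee_lne ?in_itv/= ?leey ?eta_rect_ratio_ge0 ?mule_ge0 ?inve_ge0
      ?lee_fin ?mulr_ge0 ?cdist_ge0//.
    by rewrite -rect_cross_ratio_id; apply: qm; exact: unit_circle_expi.
rewrite energyE// energy_boundE; have := rect_bound_integral_ge0 heta eta1.
have := intA_fin_num hg; have : (0 <= intB g)%E by exact: integral_ge0.
have p0 := @pi_gt0 R.
case: (intA g) => [a| |]// + _.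
(* An infinite bound leaves nothing to prove; a finite one forces [intB g] to be finite. Then 2 (b -
   a) <= 2 pi * 2 j, and the factor 1 / (2 pi^2) of the energy leaves j / pi. *)
case: (rect_bound_integral eta) => [j| |]//; last first.
  by move=> _ _ _; rewrite gt0_muley ?leey// lte_fin invr_gt0.
case: (intB g) => [b| |]// _ _.
rewrite -!(EFinM, EFinD, EFinN) !lee_fin => h.
rewrite -(@ler_pM2l _ (2 * pi ^+ 2)); last by rewrite mulr_gt0// exprn_gt0.
rewrite mulrA divff ?mul1r; last by rewrite gt_eqF// mulr_gt0// exprn_gt0.
rewrite (_ : 2 * pi ^+ 2 * (pi^-1 * j) = 2 * pi * j); first lra.
by rewrite expr2 !mulrA mulfK // gt_eqF.
Qed.

End rectangles.

(** * The identity map: a finite, positive energy that attains the bound *)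

Section identity.
Variable R : realType.
Local Notation mu := (@lebesgue_measure R).
Implicit Types (t : R).

Definition ln_ratio t : R := ln (1 + cos t) - ln (1 - cos t).

Lemma cos_lt1 t : 0 < t < pi -> cos t < 1.
Proof.
move=> /andP[t0 tpi].
by rewrite -(cos0 R) ltr_cos// in_itv/= ?lexx ?pi_ge0// ?ltW.
Qed.

Lemma cos_gtN1 t : 0 < t < pi -> -1 < cos t.
Proof.
move=> /andP[t0 tpi].
by rewrite -(cospi R) ltr_cos// in_itv/= ?lexx ?pi_ge0// ?ltW.
Qed.

Lemma is_derive_ln_ratio t : 0 < t < pi ->
  is_derive t 1 ln_ratio (- 2 / sin t).
Proof.
move=> tpi; have s0 := sin_gt0_pi tpi.
have c1 : 0 < 1 + cos t by have := cos_gtN1 tpi; lra.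
have c2 : 0 < 1 - cos t by have := cos_lt1 tpi; lra.
have d1 : is_derive t 1 (fun t => 1 + cos t) (- sin t).
  by apply: is_derive_eq; rewrite add0r mul1r.
have d2 : is_derive t 1 (fun t => 1 - cos t) (sin t).
  by apply: is_derive_eq; rewrite add0r mul1r opprK.
have l1 := is_derive1_ln c1; have l2 := is_derive1_ln c2.
have e1 := @is_derive1_comp _ (@ln R) (fun t => 1 + cos t) _ _ _ l1 d1.
have e2 := @is_derive1_comp _ (@ln R) (fun t => 1 - cos t) _ _ _ l2 d2.
apply: (is_derive_eq (is_deriveB e1 e2)).
have sE : sin t ^+ 2 = (1 + cos t) * (1 - cos t).
  by have := cos2Dsin2 t; lra.
have -> : (1 + cos t)^-1 = (1 - cos t) / sin t ^+ 2 by rewrite sE; field; lra.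
have -> : (1 - cos t)^-1 = (1 + cos t) / sin t ^+ 2 by rewrite sE; field; lra.
by field; rewrite gt_eqF.
Qed.

(** Integration by parts: the derivative of [ln_ratio] is -2 / sin t, so the remaining integrand is
    the constant 2. *)
Definition ln_ratio_primitive t : R := sin t * ln_ratio t + 2 * t.

Lemma is_derive_ln_ratio_primitive t : 0 < t < pi ->
  is_derive t 1 ln_ratio_primitive (ln_ratio t * cos t).
Proof.
move=> tpi; have dl := is_derive_ln_ratio tpi; have s0 := sin_gt0_pi tpi.
have d2 : is_derive t 1 (fun t : R => 2 * t) 2.
  by apply: is_derive_eq; rewrite /GRing.scale/= mulr1.
apply: (is_derive_eq (is_deriveD (is_deriveM (is_derive_sin t) dl) d2)).
by rewrite /GRing.scale/=; field; rewrite gt_eqF.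
Qed.

Lemma pihalf_in_pi t : 0 < t -> t <= pi / 2 -> 0 < t < pi.
Proof. by move=> t0 tp; have := @pi_gt0 R; lra. Qed.

Lemma ln_ratio_rect_ratio t : 0 < t -> t <= pi / 2 ->
  lne (cot (t / 2) ^+ 2)%:E = (ln_ratio t)%:E.
Proof.
move=> t0 tp; have tpi := pihalf_in_pi t0 tp.
have c1 := cos_gtN1 tpi; have c2 := cos_lt1 tpi.
rewrite cot_half_sqr// rect_ratio_lt1 ?ltW//.
rewrite (_ : (2 + 2 * cos t) / (2 - 2 * cos t) = (1 + cos t) / (1 - cos t)).
  by rewrite lne_EFin ?divr_gt0 ?ln_div ?posrE//; lra.
by field; apply/andP; split; apply/eqP; lra.
Qed.

Lemma rect_bound_integral_idE :
  rect_bound_integral id =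
  (\int[mu]_(t in `]0%R, (pi / 2)%R]) (ln_ratio t * cos t)%:E)%E.
Proof.
apply: eq_integral => t /set_mem/=; rewrite in_itv/= => /andP[t0 tp].
by rewrite ln_ratio_rect_ratio.
Qed.

Lemma continuous_ln_ratioMcos t : 0 < t < pi ->
  {for t, continuous (fun t => ln_ratio t * cos t)}.
Proof.
move=> tpi; have dl := is_derive_ln_ratio tpi.
have [df _] := is_deriveM dl (is_derive_cos t).
by apply: differentiable_continuous; apply/derivable1_diffP.
Qed.

Lemma continuous_ln_ratio_primitive t : 0 < t < pi ->
  {for t, continuous ln_ratio_primitive}.
Proof.
move=> tpi; have [df _] := is_derive_ln_ratio_primitive tpi.
by apply: differentiable_continuous; apply/derivable1_diffP.
Qed.

Lemma ln_ratio_ge0 t : 0 < t -> t <= pi / 2 -> 0 <= ln_ratio t.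
Proof.
move=> t0 tp; have tpi := pihalf_in_pi t0 tp.
have c1 := cos_gtN1 tpi; have c2 := cos_lt1 tpi.
have c0 : 0 <= cos t by apply: cos_ge0_pihalf; lra.
by rewrite subr_ge0 ler_ln ?posrE; lra.
Qed.

(** [ln_ratio] blows up at 0, hence the cut at e. The primitive equals pi at pi / 2, where
    [ln_ratio] vanishes, and is nonnegative at e, so the bound is uniform in e. *)
Lemma integral_ln_ratio_le (e : R) : 0 < e -> e < pi / 2 ->
  (\int[mu]_(t in `[e, (pi / 2)%R]) (ln_ratio t * cos t)%:E <= pi%:E)%E.
Proof.
move=> e0 ep.
have inpi t : t \in `[e, pi / 2] -> 0 < t < pi.
  rewrite in_itv/= => /andP[et tp]; apply: pihalf_in_pi => //.
  exact: lt_le_trans et.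
rewrite (@continuous_FTC2 _ _ ln_ratio_primitive)//.
- rewrite -EFinB lee_fin /ln_ratio_primitive sin_pihalf {1}/ln_ratio cos_pihalf.
  rewrite addr0 subr0 subrr mulr0 add0r.
  have s0 : 0 <= sin e.
    by rewrite ltW// sin_gt0_pi// inpi// in_itv/= lexx ltW.
  have := mulr_ge0 s0 (ln_ratio_ge0 e0 (ltW ep)); lra.
- apply: continuous_in_subspaceT => t /set_mem/= /inpi.
  exact: continuous_ln_ratioMcos.
- split.
  + move=> t /subset_itv_oo_cc/inpi tpi.
    by have [] := is_derive_ln_ratio_primitive tpi.
  + apply: cvg_at_right_filter; apply: continuous_ln_ratio_primitive.
    by apply: inpi; rewrite in_itv/= lexx ltW.
  + apply: cvg_at_left_filter; apply: continuous_ln_ratio_primitive.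
    by apply: inpi; rewrite in_itv/= lexx ltW.
- move=> t /subset_itv_oo_cc/inpi tpi.
  by rewrite derive1E; have [_ ->] := is_derive_ln_ratio_primitive tpi.
Qed.

Lemma control_function_id : control_function (id : \bar R -> \bar R).
Proof. by []. Qed.

Lemma rect_bound_integral_id_lty :
  (rect_bound_integral (id : \bar R -> \bar R) < +oo)%E.
Proof.
rewrite rect_bound_integral_idE.
apply: (@le_lt_trans _ _ pi%:E); last exact: ltry.
(* Monotone convergence along these intervals carries the uniform bound to ]0, pi / 2]. The offset 2
   keeps the left end below 1 <= pi / 2. *)
pose F n := `[(n.+2%:R^-1 : R), pi / 2]%classic.
have p1 := @pihalf_ge1 R.
have e0 n : 0 < n.+2%:R^-1 :> R by rewrite invr_gt0.
have FU : `]0, (pi / 2)]%classic = \bigcup_n F n.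
  apply/seteqP; split => [t /=|t [n _]]; rewrite /F/= !in_itv/=.
    move=> /andP[t0 tp]; have [k] := ltr_add_invr t0; rewrite add0r => kt.
    exists k => //=; rewrite in_itv/= tp andbT (le_trans _ (ltW kt))//.
    by rewrite lef_pV2 ?posrE// ler_nat.
  by move=> /andP[t0 ->]; rewrite (lt_le_trans (e0 n) t0).
have f0 t : 0 < t -> t <= pi / 2 -> 0 <= ln_ratio t * cos t.
  by move=> t0 tp; rewrite mulr_ge0 ?ln_ratio_ge0// cos_ge0_pihalf//; lra.
have cf n : {within F n, continuous (fun t => ln_ratio t * cos t)}.
  apply: continuous_in_subspaceT => t /set_mem.
  rewrite /F/= in_itv/= => /andP[t0 tp].
  apply: continuous_ln_ratioMcos; apply: pihalf_in_pi => //.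
  exact: lt_le_trans t0.
have := @ge0_nondecreasing_set_cvg_integral _ (measurableTypeR R) R F
  (fun t => (ln_ratio t * cos t)%:E) mu.
rewrite -FU => H.
have {}H : (\int[mu]_(t in F n) (ln_ratio t * cos t)%:E @[n --> \oo] -->
    \int[mu]_(t in `]0%R, (pi / 2)%R]) (ln_ratio t * cos t)%:E)%E.
  apply: H.
  - apply/nondecreasing_seqP => n; rewrite subsetEset => t.
    rewrite /F/= !in_itv/=.
    move=> /andP[nt ->]; rewrite andbT (le_trans _ nt)//.
    by rewrite lef_pV2 ?posrE// ler_nat.
  - by move=> n; exact: measurable_itv.
  - move=> n; apply/measurable_EFinP.
    apply: subspace_continuous_measurable_fun; last exact: cf.
    exact: measurable_itv.
  - move=> n t; rewrite /F/= in_itv/= => /andP[t0 tp].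
    by rewrite lee_fin f0// (lt_le_trans _ t0).
rewrite -(cvg_lim _ H)//.
apply: lime_le; first by apply/cvg_ex; eexists; exact: H.
apply: nearW => n; apply: integral_ln_ratio_le => //.
rewrite (lt_le_trans _ p1)// invf_lt1// ltr1n//.
Qed.

Lemma rect_bound_integral_id_gt0 :
  (0 < rect_bound_integral (id : \bar R -> \bar R))%E.
Proof.
have p0 := @pi_gt0 R.
have e1 : (1 <= id (1 : \bar R))%E by [].
rewrite -(integral_rect_bound_pi control_function_id)//.
pose c := cos (pi / 4 : R).
have c0 : 0 < c by apply: cos_gt0_pihalf; lra.
have c1 : c < 1 by apply: cos_lt1; lra.
have q1 : 1 < (2 + 2 * c) / (2 - 2 * c) by rewrite ltr_pdivlMr; lra.
(* This is the value of the integrand at pi / 4. Both factors decrease in t, so k bounds the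
   integrand from below on [0, pi / 4], including t = 0 where the ratio is +oo. *)
pose k := ln ((2 + 2 * c) / (2 - 2 * c)) * c.
have k0 : 0 < k by rewrite mulr_gt0// ln_gt0.
apply: (@lt_le_trans _ _ (\int[mu]_(t in `[0%R, (pi / 4)%R]) cst k%:E t)%E).
  rewrite (integral_cst mu)//= lebesgue_measure_itv/= lte_fin divr_gt0//.
  by rewrite -EFinD subr0 -EFinM lte_fin mulr_gt0// divr_gt0.
apply: (@le_trans _ _ (\int[mu]_(t in `[0%R, (pi / 4)%R]) rect_bound id t)%E).
  apply: ge0_le_integral => //.
  - by move=> t _; rewrite lee_fin ltW.
  - apply: measurable_funTS.
    exact: measurable_rect_bound control_function_id.
  - move=> t /=; rewrite in_itv/= => /andP[t0 tp].
    have ct : c <= cos t.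
      by rewrite leNgt ltr_cos ?in_itv/=; [rewrite -leNgt|lra|lra].
    rewrite /rect_bound /cosp max_l; last by lra.
    rewrite /k EFinM; apply: lee_pmul => //.
    + by rewrite lee_fin ltW// ln_gt0.
    + by rewrite lee_fin ltW.
    rewrite -lne_EFin; last lra.
    rewrite -rect_ratio_lt1; [|lra..].
    by rewrite lee_lne ?in_itv/= ?leey ?rect_ratio_ge0// rect_ratio_nd.
apply: ge0_subset_integral => //.
- by apply: measurable_funTS; exact: measurable_rect_bound control_function_id.
- by move=> t _; exact: rect_bound_ge0 control_function_id e1 t.
- by move=> t; rewrite /= !in_itv/= => /andP[-> tp]; lra.
Qed.

(** For the identity the rectangle term is exactly [rect_bound id], so the integrated relation is an
    equality. Finiteness of its right-hand side makes [intB id] finite and lets the relation be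
    solved for b - a. *)
Lemma energy_id : energy (id : R[i]^o -> R[i]^o) = energy_bound id.
Proof.
have hid := circle_homeo_id R.
have e1 : (1 <= id (1 : \bar R))%E by [].
have : (intB id + intB id = intA id + intA id + (2 * pi)%:E *
    (rect_bound_integral id + rect_bound_integral id) :> \bar R)%E.
  rewrite -intB_double// -(integral_kerA_rect_bound control_function_id e1 hid).
  apply: eq_integral => -[t s] _.
  by rewrite /= kerB_rectangle// rect_cross_ratio_id.
rewrite energyE// energy_boundE.
have := rect_bound_integral_id_lty; have := rect_bound_integral_id_gt0.
have := intA_fin_num hid; have p0 := @pi_gt0 R.
case: (intA id) => [a| |]//; case: (rect_bound_integral id) => [j| |]// _ _ _.
case: (intB id) => [b| |]//; rewrite -?(EFinM, EFinD, EFinN)// => -[h].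
congr EFin.
rewrite (_ : b - a = 2 * pi * j); last by lra.
by move: pi p0 => p p0; field; rewrite gt_eqF.
Qed.

End identity.

Theorem theorem1 (R : realType) :
  (forall (eta : \bar R -> \bar R) (g : R[i]^o -> R[i]^o),
      control_function eta -> circle_homeo g -> quasi_mobius eta g ->
      (energy g <= energy_bound eta)%E) /\
  (exists (eta : \bar R -> \bar R) (g : R[i]^o -> R[i]^o),
      [/\ control_function eta
          /\ (forall x y, (0 <= x)%E -> (x < y)%E -> (eta x < eta y)%E),
          circle_homeo g,
          quasi_mobius eta g,
          (0 < energy g < +oo)%E &
          energy g = energy_bound eta]).
Proof.
split; first exact: energy_le_bound.
have ip : 0 < pi^-1 :> R by rewrite invr_gt0 pi_gt0.
(* The quasi-Möbius inequality is here an equality of cross-ratios. A positive and finite energy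
   excludes the degenerate equalities 0 = 0 and +oo = +oo. *)
exists id, id; split => //.
- exact: circle_homeo_id.
- rewrite energy_id energy_boundE.
  rewrite mule_gt0 ?lte_fin ?rect_bound_integral_id_gt0//=.
  by rewrite lte_mul_pinfty ?lee_fin ?(ltW ip)// rect_bound_integral_id_lty.
- exact: energy_id.
Qed.
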